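(* Let $(A,[\cdot,\cdot],\diamond,\cdot,\vartriangleright)$ be an almost tridendriform Poisson algebra. Define, for $x,y\in A$, $$x\circ y=x\vartriangleright y+y\vartriangleright x+x\cdot y,\qquad \{x,y\}=x\diamond y-y\diamond x+[x,y].$$ Then $(A,\{\cdot,\cdot\},\circ)$ is an almost Poisson algebra.
   Context: All vector spaces are finite dimensional over a field $\mathbb{K}$ of characteristic zero. An almost Poisson algebra $(A,[\cdot,\cdot],\cdot)$ is a vector space with a commutative associative bilinear product $\cdot$ and a skew-symmetric bilinear bracket satisfying $[x,y\cdot z]=[x,y]\cdot z+y\cdot[x,z]$ (no Jacobi identity is assumed). A commutative dendriform trialgebra is a vector space $A$ with bilinear operations $\cdot,\vartriangleright$ such that $(A,\cdot)$ is a commutative associative algebra and, with $x\circ y=x\vartriangleright y+y\vartriangleright x+x\cdot y$, for all $x,y,z\in A$: $(x\circ y)\vartriangleright z=x\vartriangleright(y\vartriangleright z)$ and $(x\vartriangleright y)\cdot z=x\vartriangleright(y\cdot z)$. An almost tridendriform Poisson algebra $(A,[\cdot,\cdot],\diamond,\cdot,\vartriangleright)$ is a vector space with four bilinear operations such that $(A,[\cdot,\cdot],\cdot)$ is an almost Poisson algebra, $(A,\cdot,\vartriangleright)$ is a commutative dendriform trialgebra, and for all $x,y,z\in A$: $$x\diamond(y\cdot z)=(x\diamond y)\cdot z+y\cdot(x\diamond z),$$ $$[x,z\vartriangleright y]=z\vartriangleright[x,y]-y\cdot(z\diamond x),$$ $$(y\circ z)\diamond x=z\vartriangleright(y\diamond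 x)+y\vartriangleright(z\diamond x),$$ $$\{x,z\}\vartriangleright y=x\diamond(z\vartriangleright y)-z\vartriangleright(x\diamond y),$$ where $x\circ y=x\vartriangleright y+y\vartriangleright x+x\cdot y$ and $\{x,y\}=x\diamond y-y\diamond x+[x,y]$. *)

(* Defs.v *)
From mathcomp Require Import all_boot all_algebra.

Set Implicit Arguments.
Unset Strict Implicit.
Unset Printing Implicit Defensive.

Import GRing.Theory.

Local Open Scope ring_scope.

Section AlmostTridendriformPoisson.

(* Finite-dimensional vector spaces are vectTypes. The operations are plain
   functions A -> A -> A, since one carrier bears several products and two
   brackets; bilinearity is part of each structure below.
   Naming: brk x y is [x, y], mul is the dot, dia is the diamond, rt is the
   right-pointing triangle, circ_mul mul rt x y is x \circ y and
   curly_brk brk dia x y is {x, y}. *)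
Variables (K : fieldType) (A : vectType K).

Record comm_assoc_algebra (mul : A -> A -> A) : Prop := CommAssocAlgebra {
  comm_assoc_bilinear : bilinear_for *:%R *:%R mul;
  comm_assoc_mulC : commutative mul;
  comm_assoc_mulA : associative mul
}.

Record almost_Poisson_algebra (brk mul : A -> A -> A) : Prop :=
  AlmostPoissonAlgebra {
  almost_Poisson_mul : comm_assoc_algebra mul;
  almost_Poisson_brk_bilinear : bilinear_for *:%R *:%R brk;
  almost_Poisson_skew : forall x y, brk x y = - brk y x;
  almost_Poisson_Leibniz : forall x y z,
    brk x (mul y z) = mul (brk x y) z + mul y (brk x z)
}.

Definition circ_mul (mul rt : A -> A -> A) (x y : A) : A :=
  rt x y + rt y x + mul x y.

Definition curly_brk (brk dia : A -> A -> A) (x y : A) : A :=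
  dia x y - dia y x + brk x y.

Record comm_dendriform_trialgebra (mul rt : A -> A -> A) : Prop :=
  CommDendriformTrialgebra {
  comm_tridend_mul : comm_assoc_algebra mul;
  comm_tridend_rt_bilinear : bilinear_for *:%R *:%R rt;
  comm_tridend_circ_rt : forall x y z,
    rt (circ_mul mul rt x y) z = rt x (rt y z);
  comm_tridend_rt_mul : forall x y z, mul (rt x y) z = rt x (mul y z)
}.

Record almost_tridendriform_Poisson_algebra (brk dia mul rt : A -> A -> A) :
    Prop := AlmostTridendriformPoissonAlgebra {
  almost_tridend_Poisson : almost_Poisson_algebra brk mul;
  almost_tridend_trialgebra : comm_dendriform_trialgebra mul rt;
  almost_tridend_dia_bilinear : bilinear_for *:%R *:%R dia;
  almost_tridend_dia_mul : forall x y z,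
    dia x (mul y z) = mul (dia x y) z + mul y (dia x z);
  almost_tridend_brk_rt : forall x y z,
    brk x (rt z y) = rt z (brk x y) - mul y (dia z x);
  almost_tridend_circ_dia : forall x y z,
    dia (circ_mul mul rt y z) x = rt z (dia y x) + rt y (dia z x);
  almost_tridend_curly_rt : forall x y z,
    rt (curly_brk brk dia x z) y = dia x (rt z y) - rt z (dia x y)
}.

End AlmostTridendriformPoisson.

(* Main.v *)
Require Import Defs.
From mathcomp Require Import all_boot all_algebra.

Set Implicit Arguments.
Unset Strict Implicit.
Unset Printing Implicit Defensive.

Import GRing.Theory.

Local Open Scope ring_scope.

(** The new product and bracket are sums of the given operations and their
    flips, so bilinearity, commutativity and skew-symmetry are immediate; the
    content lies in associativity and in the Leibniz rule.

    Write L(x) for the operator y |-> rt x y, D(x) for y |-> dia x y, and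
    x o y, {x, y} for the new product and bracket.  The trialgebra axioms say
    that L is a representation of o, L(x o y) = L(x) L(y), and that mul is
    linear over it.  As o is commutative, the operators L(x) commute, and
    (x o y) o z expands to the sum of three nested triangles, three mixed terms
    and one dot product, which is visibly symmetric in x and z
    ([circ_mul_expand]).  A commutative product with that symmetry is
    associative.

    For the Leibniz rule, {x, y o z} is the sum of D(x)(y o z), - D(y o z) x and
    [x, y o z].  The commutator axiom D(x) L(z) = L(z) D(x) + L({x, z}) together
    with the derivation property of D(x) expands the first
    ([dia_circ]), an axiom expands the second, and the two Leibniz-type rules
    for [x, -] expand the third ([brk_circ]).  The 14 resulting terms are those
    of {x, y} o z + y o {x, z}: the correction terms - mul y (dia z x) of the
    bracket supply exactly the part of mul y {x, z} that comes from - dia z x. *)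

Section BilinearCombinations.
Variables (K : fieldType) (A : vectType K).
Implicit Types f g : A -> A -> A.

Lemma bilinear_flip f :
  bilinear_for *:%R *:%R f -> bilinear_for *:%R *:%R (fun x y => f y x).
Proof. by case. Qed.

Lemma bilinear_opp f :
  bilinear_for *:%R *:%R f -> bilinear_for *:%R *:%R (fun x y => - f x y).
Proof.
by case=> fl fr; split=> u a x y /=; rewrite ?(fl u a) ?(fr u a) opprD scalerN.
Qed.

Lemma bilinear_add f g :
  bilinear_for *:%R *:%R f -> bilinear_for *:%R *:%R g ->
  bilinear_for *:%R *:%R (fun x y => f x y + g x y).
Proof.
case=> fl fr [gl gr]; split=> u a x y /=.
  by rewrite (fl u a) (gl u a) scalerDr addrACA.
by rewrite (fr u a) (gr u a) scalerDr addrACA.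
Qed.

Lemma bilinearBr f (bf : bilinear_for *:%R *:%R f) x y z :
  f x (y - z) = f x y - f x z.
Proof. exact: (zmod_morphism_linear (bf.2 x)). Qed.

Lemma bilinearDr f (bf : bilinear_for *:%R *:%R f) x y z :
  f x (y + z) = f x y + f x z.
Proof. by rewrite -[y in RHS](addrK z) (bilinearBr bf) subrK. Qed.

Lemma bilinearDl f (bf : bilinear_for *:%R *:%R f) x y z :
  f (x + y) z = f x z + f y z.
Proof. exact: (bilinearDr (bilinear_flip bf) z x y). Qed.

End BilinearCombinations.

Section Trialgebra.
Variables (K : fieldType) (A : vectType K) (mul rt : A -> A -> A).
Hypothesis triA : comm_dendriform_trialgebra mul rt.

Let mulC : commutative mul := comm_assoc_mulC (comm_tridend_mul triA).
Let mulA : associative mul := comm_assoc_mulA (comm_tridend_mul triA).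
Let circ_rt := comm_tridend_circ_rt triA.
Let rt_mul := comm_tridend_rt_mul triA.
Let mul_bilinear := comm_assoc_bilinear (comm_tridend_mul triA).
Let rt_bilinear := comm_tridend_rt_bilinear triA.

Let circ := circ_mul mul rt.

Lemma circ_mulC : commutative circ.
Proof. by move=> x y; rewrite /circ /circ_mul mulC [rt x y + _]addrC. Qed.

Lemma circ_mul_bilinear : bilinear_for *:%R *:%R circ.
Proof.
by apply: bilinear_add mul_bilinear; apply/bilinear_add/bilinear_flip.
Qed.

(** Triangle operators commute because they represent a commutative product. *)
Lemma rt_comm x y z : rt x (rt y z) = rt y (rt x z).
Proof. by rewrite -!circ_rt -/circ circ_mulC. Qed.

(** The three groups of terms are separately invariant under exchanging [x] and
    [z], by commutativity of [mul] and of the triangle operators. *)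
Lemma circ_mul_expand x y z :
  circ (circ x y) z =
    rt x (rt y z) + rt z (rt x y) + rt z (rt y x)
    + (rt z (mul x y) + rt x (mul y z) + rt y (mul x z)) + mul (mul x y) z.
Proof.
rewrite {1}/circ {1}/circ_mul circ_rt.
rewrite /circ /circ_mul !(bilinearDr rt_bilinear).
by rewrite !(bilinearDl mul_bilinear) !rt_mul !addrA.
Qed.

Lemma circ_mulA : associative circ.
Proof.
move=> x y z.
(* By commutativity, associativity is invariance under reversing x, y, z. *)
rewrite [circ x _]circ_mulC [circ y z]circ_mulC !circ_mul_expand.
have -> : mul (mul z y) x = mul (mul x y) z by rewrite mulC [mul z y]mulC mulA.
rewrite [mul z y]mulC [mul y x]mulC [mul z x]mulC (rt_comm x z y).
by rewrite [rt x (mul y z) + _]addrC [rt z (rt y x) + _ + _](ACl (3*2*1)).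
Qed.

Lemma circ_mul_comm_assoc : comm_assoc_algebra circ.
Proof.
by split; [exact: circ_mul_bilinear | exact: circ_mulC | exact: circ_mulA].
Qed.

End Trialgebra.

Section TridendriformPoisson.
Variables (K : fieldType) (A : vectType K) (brk dia mul rt : A -> A -> A).
Hypothesis PA : almost_tridendriform_Poisson_algebra brk dia mul rt.

Let brkA := almost_tridend_Poisson PA.
Let triA := almost_tridend_trialgebra PA.
Let mulC : commutative mul := comm_assoc_mulC (comm_tridend_mul triA).
Let mul_bilinear := comm_assoc_bilinear (comm_tridend_mul triA).
Let rt_bilinear := comm_tridend_rt_bilinear triA.
Let dia_bilinear := almost_tridend_dia_bilinear PA.
Let brk_bilinear := almost_Poisson_brk_bilinear brkA.

Let circ := circ_mul mul rt.
Let curly := curly_brk brk dia.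

Lemma curly_brk_bilinear : bilinear_for *:%R *:%R curly.
Proof.
apply: bilinear_add brk_bilinear; apply: bilinear_add dia_bilinear _.
exact/bilinear_opp/bilinear_flip.
Qed.

Lemma curly_brk_skew x y : curly x y = - curly y x.
Proof.
rewrite /curly /curly_brk (almost_Poisson_skew brkA x y).
by rewrite [in RHS]opprD opprB.
Qed.

(** [dia x] is a derivation of [mul], while moving it past a triangle operator
    [rt u] leaves the commutator [rt (curly x u)]. *)
Lemma dia_circ x y z :
  dia x (circ y z) =
    rt (curly x y) z + rt (curly x z) y + rt y (dia x z) + rt z (dia x y)
    + mul (dia x y) z + mul y (dia x z).
Proof.
have dia_rt u v : dia x (rt u v) = rt (curly x u) v + rt u (dia x v).
  by rewrite /curly (almost_tridend_curly_rt PA) subrK.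
rewrite /circ /circ_mul !(bilinearDr dia_bilinear) !dia_rt.
rewrite (almost_tridend_dia_mul PA) !addrA.
by rewrite [LHS](ACl (1*3*2*4*5*6)).
Qed.

Lemma brk_circ x y z :
  brk x (circ y z) =
    rt y (brk x z) + rt z (brk x y) - mul z (dia y x) - mul y (dia z x)
    + mul (brk x y) z + mul y (brk x z).
Proof.
rewrite /circ /circ_mul !(bilinearDr brk_bilinear) !(almost_tridend_brk_rt PA).
by rewrite (almost_Poisson_Leibniz brkA) !addrA [LHS](ACl (1*3*2*4*5*6)).
Qed.

Lemma curly_circ_Leibniz x y z :
  curly x (circ y z) = circ (curly x y) z + circ y (curly x z).
Proof.
have rtE u v :
    rt v (curly x u) = rt v (dia x u) - rt v (dia u x) + rt v (brk x u).
  by rewrite /curly /curly_brk (bilinearDr rt_bilinear) (bilinearBr rt_bilinear).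
have mulE u v :
    mul v (curly x u) = mul v (dia x u) - mul v (dia u x) + mul v (brk x u).
  by rewrite /curly /curly_brk (bilinearDr mul_bilinear) (bilinearBr mul_bilinear).
rewrite {1}/curly /curly_brk dia_circ brk_circ (almost_tridend_circ_dia PA).
rewrite [in RHS]/circ /circ_mul !rtE [mul (curly x y) z]mulC !mulE.
rewrite [mul (dia x y) z]mulC [mul (brk x y) z]mulC opprD !addrA.
(* On the left, terms 1-6 come from dia_circ, 7-8 from dia (circ y z) x and
   9-14 from brk_circ. *)
by rewrite [LHS](ACl (1*4*7*10*5*11*13*3*8*9*2*6*12*14)).
Qed.

End TridendriformPoisson.

Theorem theorem4p9 (K : fieldType) (charK0 : [pchar K] =i pred0)
    (A : vectType K) (brk dia mul rt : A -> A -> A) :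
  almost_tridendriform_Poisson_algebra brk dia mul rt ->
  almost_Poisson_algebra (curly_brk brk dia) (circ_mul mul rt).
Proof.
move=> PA; split.
- exact: circ_mul_comm_assoc (almost_tridend_trialgebra PA).
- exact: curly_brk_bilinear PA.
- exact: curly_brk_skew PA.
- exact: curly_circ_Leibniz PA.
Qed.
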